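(* Every simple graph $G$ satisfies $\chi'_{\rm s}(G)\le (2\bar{d}(G)-1)\chi'(G)$.
   Context: The maximum average degree is $\bar{d}(G)=\max\{2|E(H)|/|V(H)| : H\subseteq G\}$. $\chi'(G)$ is the chromatic index (least number of colors in a proper edge coloring). $\chi'_{\rm s}(G)$ is the strong chromatic index: the least $k$ such that $G$ has an edge $k$-coloring in which any two edges at distance at most two (adjacent, or both adjacent to a common edge) receive distinct colors. *)

(* Defs.v *)
From mathcomp Require Import all_boot all_order all_algebra.
Set Implicit Arguments. Unset Strict Implicit. Unset Printing Implicit Defensive.
Import Order.TTheory GRing.Theory Num.Theory.

Record sgraph := SGraph {
  svertex :> finType;
  sedge : rel svertex;
  sedge_sym : symmetric sedge;
  sedge_irrefl : irreflexive sedge }.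

Definition edges (G : sgraph) : {set {set G}} :=
  [set [set p.1; p.2] | p : G * G & sedge p.1 p.2].

Definition edge (G : sgraph) : finType := {e : {set G} | e \in edges G}.

Definition adjacent (G : sgraph) (e f : edge G) : bool :=
  (e != f) && (val e :&: val f != set0).

Definition within_two (G : sgraph) (e f : edge G) : bool :=
  (e != f) &&
  (adjacent e f || [exists g : edge G, adjacent e g && adjacent g f]).

(* Only genuine edges are coloured, so an edgeless graph is 0-colourable. *)
Definition separates (G : sgraph) (r : rel (edge G)) (k : nat)
    (c : {ffun edge G -> 'I_k}) : bool :=
  [forall e : edge G, forall f : edge G, r e f ==> (c e != c f)].

Definition edge_colourable (G : sgraph) (k : nat) : bool :=
  [exists c : {ffun edge G -> 'I_k}, separates (@adjacent G) c].

Definition strong_edge_colourable (G : sgraph) (k : nat) : bool :=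
  [exists c : {ffun edge G -> 'I_k}, separates (@within_two G) c].

Lemma separates_enum_rank (G : sgraph) (r : rel (edge G)) :
  (forall e f, r e f -> e != f) ->
  separates r [ffun e : edge G => enum_rank e].
Proof.
move=> rP; apply/forallP=> e; apply/forallP=> f; apply/implyP=> /rP.
by rewrite !ffunE (inj_eq enum_rank_inj).
Qed.

Lemma edge_colourable_ex (G : sgraph) : exists k, edge_colourable G k.
Proof.
exists #|edge G|; apply/existsP; exists [ffun e : edge G => enum_rank e].
by apply: separates_enum_rank => e f /andP[].
Qed.

Lemma strong_edge_colourable_ex (G : sgraph) :
  exists k, strong_edge_colourable G k.
Proof.
exists #|edge G|; apply/existsP; exists [ffun e : edge G => enum_rank e].
by apply: separates_enum_rank => e f /andP[].
Qed.

Definition chromatic_index (G : sgraph) : nat :=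
  ex_minn (edge_colourable_ex G).

Definition strong_chromatic_index (G : sgraph) : nat :=
  ex_minn (strong_edge_colourable_ex G).

Local Open Scope ring_scope.

(* H = (vertex set, edge set); the vertex set is required to be nonempty so
   that the average degree makes sense. *)
Definition is_subgraph (G : sgraph) (H : {set G} * {set {set G}}) : bool :=
  [&& H.1 != set0, H.2 \subset edges G & [forall e in H.2, e \subset H.1]].

Definition average_degree (G : sgraph) (H : {set G} * {set {set G}}) : rat :=
  2%:R * #|H.2|%:R / #|H.1|%:R.

(* The average degrees are nonnegative, so the default value 0 only matters
   for the graph without vertices, which has no subgraph in the above sense. *)
Definition max_average_degree (G : sgraph) : rat :=
  \big[Order.max/0]_(H : {set G} * {set {set G}} | is_subgraph H)
    average_degree H.

(* Main.v *)
(** In a colour class [S] of a proper edge colouring the edges are disjoint, so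
    they cover [2|S|] vertices, and these span at most [d |S|] edges of [G],
    where [d] is the maximum average degree.  The edges of [S] themselves
    account for [|S|] of these; every pair of edges of [S] at distance two
    accounts for a further one.  Hence the conflict graph on [S] has average
    degree at most [2d - 2], the same holds for all its induced subgraphs, and
    greedy colouring needs at most [2d - 1] colours for each class. *)
Require Import Defs.
From mathcomp Require Import all_boot all_order all_algebra.
Set Implicit Arguments. Unset Strict Implicit. Unset Printing Implicit Defensive.
Import Order.TTheory GRing.Theory Num.Theory.
Local Open Scope ring_scope.

(** Greedy colouring: set aside a vertex with at most [k] neighbours and colour the rest by
    induction. The degree bound ranges over all nonempty subsets of [A] so that it survives the
    deletion. *)
Lemma degenerate_colouring (T : finType) (r : rel T) (k : nat) (A : {set T}) :
  symmetric r -> irreflexive r ->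
  (forall S : {set T}, S \subset A -> S != set0 ->
     exists2 x, x \in S & (#|[set y in S | r x y]| <= k)%N) ->
  exists c : T -> 'I_k.+1, {in A &, forall x y, r x y -> c x != c y}.
Proof.
move=> rsym rirr.
elim: {A}#|A| {-2}A (erefl #|A|) => [|n IHn] A cardA degA.
  exists (fun=> ord0) => x y; move/eqP: cardA.
  by rewrite cards_eq0 => /eqP->; rewrite inE.
have A0 : A != set0 by rewrite -card_gt0 cardA.
have [x xA degx] := degA A (subxx A) A0.
have [||c cP] := IHn (A :\ x).
- by apply/eqP; rewrite -eqSS -cardA (cardsD1 x A) xA.
- by move=> S sSA; apply: degA; apply: subset_trans sSA (subD1set A x).
(* The at most [k] neighbours of [x] cannot use up all [k.+1] colours. *)
have [i iP] : exists i, i \notin [set c y | y in [set y in A | r x y]].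
  apply/existsP; rewrite -negb_forall; apply/negP => /forallP im.
  have := leq_trans (leq_imset_card c _) degx.
  by rewrite (eq_card (B := 'I_k.+1)) ?card_ord ?ltnn // => i; rewrite im.
have xi y : y \in A -> r x y -> i != c y.
  move=> yA rxy; apply: contraNneq iP => ->.
  by apply: imset_f; rewrite inE yA.
exists (fun y => if y == x then i else c y) => y z yA zA.
have [->|yx] := eqVneq y x; have [->|zx] := eqVneq z x.
- by rewrite rirr.
- exact: xi.
- by rewrite rsym eq_sym; apply: xi.
- by apply: cP; rewrite !inE ?yx ?zx.
Qed.

(** Generic in [r] and in the palette [C], so that it serves both indices and allows pairs as
    colours. *)
Lemma separates_index_le (G : sgraph) (r : rel (edge G)) (C : finType)
    (c : edge G -> C) (ex : exists k, [exists c : {ffun edge G -> 'I_k},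
      separates r c]) :
  (forall e f, r e f -> c e != c f) -> (ex_minn ex <= #|C|)%N.
Proof.
move=> cP; case: ex_minnP => m _; apply.
apply/existsP; exists [ffun e => enum_rank (c e)].
apply/forallP=> e; apply/forallP=> f; apply/implyP=> /cP.
by rewrite !ffunE (inj_eq enum_rank_inj).
Qed.

Section Conflicts.

Variable G : sgraph.
Implicit Types (e f g : edge G) (S : {set edge G}).

Lemma adjacent_sym : symmetric (@adjacent G).
Proof. by move=> e f; rewrite /adjacent eq_sym setIC. Qed.

Lemma within_two_sym : symmetric (@within_two G).
Proof.
move=> e f; rewrite /within_two eq_sym adjacent_sym; congr (_ && (_ || _)).
by apply: eq_existsb => g; rewrite andbC adjacent_sym (adjacent_sym g).
Qed.

Lemma within_two_irrefl : irreflexive (@within_two G).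
Proof. by move=> e; rewrite /within_two eqxx. Qed.

Lemma edgeP e :
  exists x y, [/\ val e = [set x; y], sedge x y & x != y].
Proof.
have /imsetP[[x y] + ->] := valP e; rewrite inE /= => xy.
by exists x, y; split=> //; apply: contraTneq xy => ->; rewrite sedge_irrefl.
Qed.

Lemma card_edge e : #|val e| = 2%N.
Proof. by have [x [y [-> _ xy]]] := edgeP e; rewrite cards2 xy. Qed.

(** Oriented edges are counted so that a conflict between [e] and [f] appears once from each side,
    as in a degree sum. *)
Definition darts (A B : {set G}) : {set G * G} :=
  [set p | [&& p.1 \in A, p.2 \in B & sedge p.1 p.2]].

Lemma card_darts_edge e : (2 <= #|darts (val e) (val e)|)%N.
Proof.
have [x [y [-> xy nxy]]] := edgeP e.
have <- : #|[set (x, y); (y, x)]| = 2%N.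
  by rewrite cards2 xpair_eqE negb_and nxy.
apply: subset_leq_card; apply/subsetP => p.
by rewrite !inE => /orP[]/eqP-> /=; rewrite !eqxx ?orbT //= sedge_sym.
Qed.

(** The linking edge meets [e] in [u] and [f] in [v]; these differ because [e] and [f] are disjoint,
    so the linking edge is [uv]. *)
Lemma card_darts_within_two e f :
  ~~ adjacent e f -> within_two e f -> (0 < #|darts (val e) (val f)|)%N.
Proof.
move=> nef /andP[ef /orP[|/existsP[g]]]; first by rewrite (negbTE nef).
case/andP=> /andP[_ /set0Pn[u]] + /andP[_ /set0Pn[v]].
rewrite !inE => /andP[ue ug] /andP[vg vf].
have uv : u != v.
  apply: contraNneq nef => uv; rewrite /adjacent ef; apply/set0Pn.
  by exists u; rewrite inE ue uv.
apply/card_gt0P; exists (u, v); rewrite !inE ue vf /=.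
have [x [y [gE xy _]]] := edgeP g; move: ug vg uv; rewrite gE !inE.
by do 2![case/orP=> /eqP->]; rewrite ?eqxx // sedge_sym.
Qed.

(** Darts are grouped by their underlying edge, which has only two orientations. *)
Lemma card_darts_le (A : {set G}) :
  (#|darts A A| <= 2 * #|[set e in edges G | e \subset A]|)%N.
Proof.
pose ends (p : G * G) := [set p.1; p.2].
rewrite -sum1_card (partition_big ends (mem [set e in edges G | e \subset A]))
  /=; last first.
  move=> [x y]; rewrite !inE /= => /and3P[xA yA xy].
  rewrite subUset !sub1set xA yA !andbT.
  by apply/imsetP; exists (x, y); rewrite ?inE.
rewrite mulnC -sum_nat_const; apply: leq_sum => e.
rewrite inE => /andP[/imsetP[[x y] _ ->] _] /=.
rewrite sum1_card; apply: leq_trans (_ : #|[set (x, y); (y, x)]| <= 2)%N.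
  apply: subset_leq_card; apply/subsetP => -[u v]; rewrite !inE unfold_in.
  rewrite inE => /andP[/and3P[_ _ /= uv] /eqP/setP eqp].
  have nuv : u != v by apply: contraTneq uv => ->; rewrite sedge_irrefl.
  move: (eqp u) (eqp v) nuv; rewrite !inE !eqxx orbT !xpair_eqE.
  by do 2![move/esym/orP; case=> /eqP->]; rewrite ?eqxx ?orbT.
by rewrite cards2; case: (_ != _).
Qed.

Definition covered S : {set G} := \bigcup_(e in S) val e.

Lemma card_covered S : (#|covered S| <= 2 * #|S|)%N.
Proof.
rewrite mulnC -sum_nat_const.
apply: leq_trans (_ : \sum_(e in S) #|val e| <= _)%N; last first.
  by apply: leq_sum => e _; rewrite card_edge.
rewrite /covered; elim/big_rec2: _ => [|e n A _ le]; first by rewrite cards0.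
by apply: leq_trans (leq_card_setU _ _) _; rewrite leq_add2l.
Qed.

(** In a matching a vertex lies on at most one edge, so the ends of a dart determine the pair
    [(e, f)] and no dart is counted twice. *)
Lemma sum_card_darts S :
  {in S &, forall e f, ~~ adjacent e f} ->
  (\sum_(e in S) \sum_(f in S) #|darts (val e) (val f)|
     <= #|darts (covered S) (covered S)|)%N.
Proof.
move=> Smatch.
have uniqS x e f : e \in S -> f \in S -> x \in val e -> x \in val f -> e = f.
  move=> eS fS xe xf; apply/eqP; apply: contraT => ef.
  have := Smatch e f eS fS; rewrite /adjacent ef => /set0Pn[].
  by exists x; rewrite inE xe.
rewrite pair_big /=; under eq_bigr do rewrite -sum1_card.
rewrite (exchange_big_dep (mem (darts (covered S) (covered S)))) /=; last first.
  move=> [e f] [x y] /andP[eS fS]; rewrite !inE /= => /and3P[xe yf ->].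
  by rewrite andbT; apply/andP; split; apply/bigcupP; [exists e|exists f].
rewrite -[leqRHS]sum1_card; apply: leq_sum => -[x y] _.
rewrite sum1_card; apply/card_le1_eqP => -[e f] [e' f'].
rewrite unfold_in /= inE => /andP[/andP[eS fS] /and3P[/= xe yf _]].
rewrite unfold_in /= inE => /andP[/andP[e'S f'S] /and3P[/= xe' yf' _]].
by rewrite (uniqS x e e') // (uniqS y f f').
Qed.

(** The summand 2 stands for the two orientations of [e], and each conflict contributes at least one
    dart. The total is at most [2 * #|E|], hence at most the maximum average degree times
    [#|covered S|]. *)
Lemma conflict_density S :
  S != set0 -> {in S &, forall e f, ~~ adjacent e f} ->
  (\sum_(e in S) (2 + #|[set f in S | within_two e f]|))%:R
    <= 2%:R * max_average_degree G * #|S|%:R.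
Proof.
move=> S0 Smatch.
pose E := [set e in edges G | e \subset covered S].
have leE : (\sum_(e in S) (2 + #|[set f in S | within_two e f]|)
    <= 2 * #|E|)%N.
  apply: leq_trans _ (card_darts_le _); apply: leq_trans _ (sum_card_darts Smatch).
  (* The diagonal term [f = e] pays for the 2; the other terms pay for the conflicts. *)
  apply: leq_sum => e eS; rewrite (bigD1 e) //= leq_add ?card_darts_edge //.
  rewrite -sum1_card (eq_bigl (fun f => [&& f \in S, f != e & within_two e f])).
    rewrite [leqRHS](bigID (within_two e)) /=; apply: leq_trans _ (leq_addr _ _).
    rewrite (eq_bigl (fun f => (f \in S) && (f != e) && within_two e f)) //.
      by apply: leq_sum => f /andP[/andP[fS _]];
        apply: card_darts_within_two; apply: Smatch.
    by move=> f; rewrite andbA.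
  move=> f; rewrite inE; case: eqVneq => [->|//].
  by rewrite within_two_irrefl andbF.
have C0 : covered S != set0.
  have /set0Pn[e eS] := S0; have [x [y [eE _ _]]] := edgeP e.
  by apply/set0Pn; exists x; apply/bigcupP; exists e; rewrite ?eE ?inE ?eqxx.
have subH : is_subgraph (covered S, E).
  rewrite /is_subgraph C0 /=; apply/andP; split.
    by apply/subsetP => e; rewrite inE => /andP[].
  by apply/forallP => e; apply/implyP; rewrite inE => /andP[].
have : average_degree (covered S, E) <= max_average_degree G.
  exact: le_bigmax_cond.
have Cgt0 : 0 < #|covered S|%:R :> rat by rewrite ltr0n card_gt0.
rewrite /average_degree /= ler_pdivrMr // => avg.
(* The default value 0 of the maximum gives the sign needed to multiply [card_covered] by it. *)
have d_ge0 : 0 <= max_average_degree G by apply: bigmax_ge_id.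
rewrite -mulrA mulrCA -natrM.
apply: le_trans (_ : max_average_degree G * #|covered S|%:R <= _).
  by apply: le_trans _ avg; rewrite -natrM ler_nat.
by rewrite ler_wpM2l // ler_nat card_covered.
Qed.

(** Otherwise every summand in [conflict_density] is at least [2 + k.+1], which is [k.+3], and the
    sum exceeds its bound. *)
Lemma low_conflict_edge S (k : nat) :
  2%:R * max_average_degree G < k.+3%:R ->
  S != set0 -> {in S &, forall e f, ~~ adjacent e f} ->
  exists2 e, e \in S & (#|[set f in S | within_two e f]| <= k)%N.
Proof.
move=> dk S0 Smatch; apply/exists_inP; apply: contraT.
rewrite negb_exists_in => /forall_inP degS.
have /lt_le_trans: 2%:R * max_average_degree G * #|S|%:R < (k.+3 * #|S|)%:R.
  by rewrite natrM ltr_pM2r // ltr0n card_gt0.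
have : (k.+3 * #|S| <=
    \sum_(e in S) (2 + #|[set f in S | within_two e f]|))%N.
  rewrite mulnC -sum_nat_const; apply: leq_sum => e eS.
  by rewrite add2n !ltnS ltnNge degS.
rewrite -(ler_nat rat) => le1 /(_ _ le1) lt1.
by have := lt_le_trans lt1 (conflict_density S0 Smatch); rewrite ltxx.
Qed.

(** This is the density bound for the one-edge matching. *)
Lemma max_average_degree_ge1 e : 1 <= max_average_degree G.
Proof.
have := @conflict_density [set e].
rewrite big_set1 cards1 mulr1 -card_gt0 cards1 => /(_ isT) dens.
rewrite -(ler_pM2l (ltr0Sn _ 1)) mulr1; apply: le_trans _ (dens _).
  by rewrite ler_nat leq_addr.
by move=> f g /set1P-> /set1P->; rewrite /adjacent eqxx.
Qed.

End Conflicts.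

Theorem theorem8 (G : sgraph) :
  (strong_chromatic_index G)%:R <=
    (2%:R * max_average_degree G - 1) * (chromatic_index G)%:R :> rat.
Proof.
(* Without edges the factor [2d - 1] is negative, but both indices vanish. *)
have [e0 _|noedge] := pickP (edge G); last first.
  have card0 : #|edge G| = 0%N by apply: eq_card0 => e; have := noedge e.
  have index0 (r : rel (edge G)) ex : (forall e f : edge G, r e f -> e != f) ->
    @ex_minn (fun k => [exists c : {ffun edge G -> 'I_k}, separates r c]) ex = 0%N.
    move=> rP; apply/eqP; rewrite -leqn0 -card0.
    exact: (separates_index_le (c := id)).
  rewrite /strong_chromatic_index /chromatic_index !index0 ?mulr0 //.
  - by move=> e f /andP[].
  - by move=> e f /andP[].
pose d := max_average_degree G.
have d_ge : 0 <= 2%:R * d - 2%:R.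
  by rewrite subr_ge0 -{1}[2%:R]mulr1 ler_pM2l // max_average_degree_ge1.
(* With [k] the floor of [2d - 2], the upper bound [2d - 2 < k.+1] yields the low-degree edges, and
   [k <= 2d - 2] keeps the [k.+1] colours of a class within [2d - 1]. *)
pose k := Num.truncn (2%:R * d - 2%:R).
have /andP[k_le k_gt] := truncn_itv d_ge.
have dk : 2%:R * d < k.+3%:R.
  by rewrite -[k.+3]addn2 natrD -ltrBlDr.
rewrite /chromatic_index.
case: ex_minnP => q /existsP[c /forallP cP] _.
have class_match i : {in [set e | c e == i] &, forall e f, ~~ adjacent e f}.
  move=> e f; rewrite !inE => /eqP ce /eqP cf; apply/negP => ef.
  by have /forallP/(_ f) := cP e; rewrite ef ce cf eqxx.
have [i|col colP] := fin_all_exists (P := fun i (c' : edge G -> 'I_k.+1) =>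
    {in [set e | c e == i] &, forall e f, within_two e f -> c' e != c' f}).
  apply: degenerate_colouring => [||S sSi S0].
  - exact: within_two_sym.
  - exact: within_two_irrefl.
  - apply: low_conflict_edge => // e f eS fS.
    by apply: (class_match i); apply: (subsetP sSi).
(* Each edge gets its class together with its colour inside that class; conflicting edges differ in
   the first coordinate or, within one class, in the second. *)
have : (strong_chromatic_index G <= #|{: 'I_q * 'I_k.+1}|)%N.
  apply: (separates_index_le (c := fun e => (c e, col (c e) e))) => e f ef.
  rewrite xpair_eqE negb_and; case: eqVneq => //= cef.
  by rewrite -cef; apply: colP; rewrite ?inE ?cef.
rewrite card_prod !card_ord -(ler_nat rat) mulnC natrM => /le_trans; apply.
by rewrite ler_wpM2r // -natr1 -lerBrDr -addrA -opprD.
Qed.
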